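(* Let $K$ be a quasi-metric kernel on $X$, $\sigma\in\mathcal M_+(X)$, $1<p<\infty$, $\frac1p+\frac1q=1$, and let $\omega\in\mathcal M_+(X)$. Suppose that $(K\omega)^q\in\mathcal W_{p,K}$, i.e. $(K\omega)^q$ is an $L^p$-weight for $K$: $K\omega<\infty$ $\sigma$-a.e. and there is a constant $C$ with $$\int_X (K\omega)^q\,(Kg)^p\,d\sigma\le C\int_X g^p\,d\sigma\qquad\text{for all }0\le g\in L^p(\sigma).$$ Then there is a constant $C'$ with $$\int_X (Kg)^p\,d\omega\le C'\int_X g^p\,d\sigma\qquad\text{for all }0\le g\in L^p(\sigma).$$
   Context: $X$ is a metric space and $\mathcal M_+(X)$ is the set of positive $\sigma$-finite Borel measures on $X$; $\sigma$ is the underlying measure. A quasi-metric kernel is a Borel function $K:X\times X\to(0,\infty]$ that is symmetric and for which there is a constant $\kappa\ge1$ with $\frac1{K(x,y)}\le\kappa\big(\frac1{K(x,z)}+\frac1{K(z,y)}\big)$ for all $x,y,z\in X$. For $\mu\in\mathcal M_+(X)$, $K\mu(x)=\int_X K(x,y)\,d\mu(y)$; for a nonnegative Borel function $g$, $Kg(x)=\int_X K(x,y)g(y)\,d\sigma(y)$. *)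

(* Defs.v *)
From HB Require Import structures.
From mathcomp Require Import all_boot all_order all_algebra.
From mathcomp Require Import all_classical all_reals all_analysis.
From mathcomp Require Import measurable_realfun.
Set Implicit Arguments.
Unset Strict Implicit.
Unset Printing Implicit Defensive.
Import Order.TTheory GRing.Theory Num.Theory.
Import numFieldNormedType.Exports.
Local Open Scope classical_set_scope.
Local Open Scope ring_scope.
Local Open Scope ereal_scope.

(* A measurableType is pointed, so the metric spaces that carry a Borel
   structure here are the nonempty ones. *)
#[short(type="pMetricType")]
HB.structure Definition PointedMetric (R : numDomainType) :=
  { M of Metric R M & Pointed M }.

Notation borel X := (g_sigma_algebraType (@open X)).

(* K is measurable for the Borel sets of the topological space X * X. When X is
   not separable these may be more than the product of the Borel sigma-algebra
   of X with itself. As 0 < K, 1 / K takes values in [0, +oo[, with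
   1 / +oo = 0. *)
Record quasi_metric_kernel (R : realType) (X : pMetricType R)
    (K : X -> X -> \bar R) : Prop := QuasiMetricKernel {
  qmk_measurable :
    measurable_fun [set: borel (X * X)%type]
      (fun z : borel (X * X)%type => K z.1 z.2) ;
  qmk_gt0 : forall x y, 0 < K x y ;
  qmk_sym : forall x y, K x y = K y x ;
  qmk_quasi_triangle : exists kappa : R, (1 <= kappa)%R /\
    forall x y z, (K x y)^-1 <= kappa%:E * ((K x z)^-1 + (K z y)^-1)
}.

Definition potential (R : realType) (X : pMetricType R) (K : X -> X -> \bar R)
    (mu : {measure set (borel X) -> \bar R}) (x : X) : \bar R :=
  \int[mu]_y K x y.

Definition fun_potential (R : realType) (X : pMetricType R)
    (K : X -> X -> \bar R) (sigma : {measure set (borel X) -> \bar R})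
    (g : X -> R) (x : X) : \bar R :=
  \int[sigma]_y (K x y * (g y)%:E).

(* Main.v *)
Require Import Defs.
From HB Require Import structures.
From mathcomp Require Import all_boot all_order all_algebra.
From mathcomp Require Import all_classical all_reals all_analysis.
From mathcomp Require Import measurable_realfun.
Set Implicit Arguments.
Unset Strict Implicit.
Unset Printing Implicit Defensive.
Import Order.TTheory GRing.Theory Num.Theory.
Import numFieldNormedType.Exports.
Local Open Scope classical_set_scope.
Local Open Scope ring_scope.
Local Open Scope ereal_scope.

(** Write Kg for the potential of g with respect to sigma. The heart of the
matter is the pointwise inequality
  (Kg)^p <= C K(g (Kg)^(p-1))    [potential_poweR_le],
valid for every quasi-metric kernel. Integrating it against omega, exchanging
the integrals and using Young's inequality gives
  int (Kg)^p domega <= C int g (Kg)^(p-1) (K omega) dsigma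
                    <= C (int g^p dsigma + int (Kg)^p (K omega)^q dsigma),
because (p-1) q = p; the weight condition bounds the last integral.

The pointwise inequality comes from a median argument. Fix x and split the mass
of K(x,.) g sigma into two halves, a set A where K(x,.) is large and a set B
where K(x,.) is small [integral_level_split]. If y is in A and z in B, then
K(x,z) <= 2 K(x,y), so the quasi-triangle inequality bounds K(x,z) by a
multiple of K(y,z). Integrating in z over B shows that Kg is at least a multiple
of Kg(x) on all of A, and A carries half of Kg(x).

The delicate point is the exchange of integrals. K is Borel for the topology of
X * X, which may exceed the product of the Borel sigma-algebras when X is not
separable; then Tonelli's theorem does not apply to K, and potentials such as
K omega may fail to be measurable. The remedy is a product-measurable kernel
L <= K such that, for every x, K(x,.) <= C L(x,.) holds sigma-almost everywhere
[measurable_kernel_minorant]. Such an L exists because sigma is sigma-finite: a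
disjoint family of balls of positive sigma-measure is countable, so that at each
scale the part of the near-diagonal that sigma can see is covered by countably
many squares G * G of balls. Everything that has to be measurable is expressed
with L, and the two non-measurable integrals (of (K omega)^q (Kg)^p and of
(Kg)^p) are only compared through the monotonicity of the integral, which holds
for all nonnegative functions [ge0_le_integral_lower].

The whole argument uses the kernel only through its sections and the inequality
min(K(x,z), K(z,y)) <= c K(x,y), so it is carried out on an abstract measurable
space. *)

(** * Integrals of nonnegative functions *)

(** The integral of a nonnegative function is the supremum of the integrals of
the simple functions below it, so it is monotone on nonmeasurable functions as
well. *)
Lemma ge0_le_integral_lower d (T : measurableType d) (R : realType)
    (mu : {measure set T -> \bar R}) (f g : T -> \bar R) :
  (forall x, 0 <= f x) -> (forall x, f x <= g x) ->
  \int[mu]_x f x <= \int[mu]_x g x.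
Proof.
move=> f0 fg; have g0 x : 0 <= g x by exact: le_trans (f0 x) (fg x).
rewrite !ge0_integralTE//; apply: ereal_sup_le => _ [h hf <-].
by exists h => // x; exact: le_trans (hf x) (fg x).
Qed.

Lemma integral_bigcup_nondecreasing_le d (T : measurableType d) (R : realType)
    (mu : {measure set T -> \bar R}) (f : T -> \bar R) (F : (set T)^nat)
    (b : \bar R) :
  measurable_fun [set: T] f -> (forall x, 0 <= f x) ->
  {homo F : n m / (n <= m)%N >-> n `<=` m} -> (forall n, measurable (F n)) ->
  (forall n, \int[mu]_(x in F n) f x <= b) ->
  \int[mu]_(x in \bigcup_n F n) f x <= b.
Proof.
move=> mf f0 ndF mF Fb.
have cvgF := @ge0_nondecreasing_set_cvg_integral _ _ _ F f mu _ mF.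
have : \int[mu]_(x in F i) f x @[i --> \oo] -->
       \int[mu]_(x in \bigcup_i F i) f x.
  apply: cvgF => [n m nm|n|n x _//]; first by apply/subsetPset; exact: ndF.
  exact: measurable_funS mf.
move=> cF; rewrite -(cvg_lim _ cF)//; apply: lime_le; last exact: nearW.
by apply/cvg_ex; exists (\int[mu]_(x in \bigcup_i F i) f x).
Qed.

Lemma integral_setC_ge d (T : measurableType d) (R : realType)
    (mu : {measure set T -> \bar R}) (f : T -> \bar R) (A : set T) (a : R) :
  measurable_fun [set: T] f -> (forall x, 0 <= f x) -> measurable A ->
  (a + a)%:E <= \int[mu]_x f x -> \int[mu]_(x in A) f x <= a%:E ->
  a%:E <= \int[mu]_(x in ~` A) f x.
Proof.
move=> mf f0 mA fa Aa.
have : (a + a)%:E <= a%:E + \int[mu]_(x in ~` A) f x.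
  apply: le_trans fa _; rewrite -(setUv A) ge0_integral_setU//.
  - exact: leeD2r.
  - exact: measurableC.
  - by rewrite setUv.
  - exact/disj_setPCl.
by rewrite EFinD leeD2lE.
Qed.

(** A median of k for the measure f mu, up to a factor 2. The levels considered
are s j = (j + 1) / (n + 1), where n is so large that {k > s 0} carries half of
the mass. The first j such that {k <= s (j + 1)} carries half of the mass
works, with A = {k > s j} and B = {k <= s (j + 1)}: consecutive levels have
ratio at most 2. If there is none, half of the mass sits on {k = +oo}. Working
with a finite mass a + a below the integral covers the case where the integral
is infinite. *)
Lemma integral_level_split d (T : measurableType d) (R : realType)
    (mu : {measure set T -> \bar R}) (k f : T -> \bar R) (a : R) :
  measurable_fun [set: T] k -> (forall x, 0 < k x) ->
  measurable_fun [set: T] f -> (forall x, 0 <= f x) ->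
  (0 < a)%R -> (a + a)%:E <= \int[mu]_x f x ->
  exists A B : set T,
    [/\ measurable A, measurable B,
        forall y z, A y -> B z -> k z <= 2%:E * k y,
        a%:E <= \int[mu]_(x in A) f x & a%:E <= \int[mu]_(x in B) f x].
Proof.
move=> mk k0 mf f0 a0 fa.
pose lo (t : R) := [set y | k y <= t%:E].
have mlo t : measurable (lo t).
  by rewrite -[lo t]setTI; exact: emeasurable_fun_infty_c.
have [n hin] : exists n, a%:E <= \int[mu]_(x in ~` lo (n.+1%:R^-1)%R) f x.
  apply: contrapT => nhi.
  have : (a + a)%:E <= a%:E.
    apply: le_trans fa _.
    have -> : [set: T] = \bigcup_n ~` lo (n.+1%:R^-1)%R.
      apply/seteqP; split=> // y _.
      have [ky|] := eqVneq (k y) +oo.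
        by exists 0%N => //; rewrite /lo/= ky.
      rewrite -ltey -ge0_fin_numE 1?ltW// => kfin; have := k0 y.
      rewrite -(fineK kfin) lte_fin => /ltr_add_invr[m].
      rewrite add0r => ky; exists m => //=; apply/negP.
      by rewrite -ltNge -(fineK kfin) lte_fin.
    apply: integral_bigcup_nondecreasing_le => // [i j ij|i|i].
    - apply: subsetC => y; rewrite /lo/= => /le_trans; apply.
      by rewrite lee_fin lef_pV2 ?posrE// ler_nat.
    - exact: measurableC.
    - by rewrite leNgt; apply/negP => /ltW hi; apply: nhi; exists i.
  by rewrite lee_fin gerDl leNgt a0.
pose s j : R := (n.+1%:R^-1 * j.+1%:R)%R.
have s_lo_hi j y z : (~` lo (s j)) y -> lo (s j.+1) z -> k z <= 2%:E * k y.
  move=> /negP; rewrite -ltNge => sy zs; apply: le_trans zs _.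
  apply: (@le_trans _ _ (2%:E * (s j)%:E)); last by rewrite lee_pmul2l// ltW.
  rewrite lee_fin /s mulrCA ler_pM2l ?invr_gt0// -natrM ler_nat.
  by rewrite mul2n -addnn addSn addnS !ltnS leq_addl.
pose P j := a%:E <= \int[mu]_(x in lo (s j.+1)) f x.
have [exP|nP] := pselect (exists j, P j).
  have [j Pj minj] := ex_minnP exP.
  exists (~` lo (s j)), (lo (s j.+1)); split => //.
  - exact: measurableC.
  - exact: s_lo_hi.
  - case: j Pj minj => [|j] Pj minj; first by rewrite /s mulr1.
    apply: integral_setC_ge => //; rewrite leNgt; apply/negP => /ltW /minj.
    by rewrite ltnn.
pose F j := lo (s j.+1).
have FE y : (~` \bigcup_j F j) y -> k y = +oo.
  move=> nF; apply/eqP; rewrite -leye_eq leNgt; apply/negP => ky.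
  have kfin : k y \is a fin_num by rewrite ge0_fin_numE// ltW.
  apply: nF; exists (Num.truncn (n.+1%:R * fine (k y))) => //.
  rewrite /F /lo /= -(fineK kfin) lee_fin /s mulrC ler_pdivlMr// mulrC.
  apply: (@le_trans _ _ (Num.truncn (n.+1%:R * fine (k y))).+1%:R).
    by rewrite ltW// truncnS_gt.
  by rewrite ler_nat.
have mF : measurable (\bigcup_j F j).
  by apply: bigcup_measurable => j _; exact: mlo.
have inf : a%:E <= \int[mu]_(x in ~` \bigcup_j F j) f x.
  apply: integral_setC_ge => //.
  apply: integral_bigcup_nondecreasing_le => // [i j ij y|j|j].
  - rewrite /F /lo/= => /le_trans; apply.
    by rewrite lee_fin ler_pM2l ?invr_gt0// ler_nat !ltnS.
  - exact: mlo.
  - by rewrite leNgt; apply/negP => /ltW hi; apply: nP; exists j.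
exists (~` \bigcup_j F j), (~` \bigcup_j F j); split => //.
- exact: measurableC.
- exact: measurableC.
- by move=> y z /FE -> _; rewrite gt0_muley ?lte_fin// leey.
Qed.

(** * Disjoint sets of positive measure *)

(** At most mu F * (n + 1) of the disjoint sets can meet F in measure more than
1 / (n + 1); take the union over n. *)
Lemma countable_trivIset_finite_measure d (T : measurableType d) (R : realType)
    (mu : {measure set T -> \bar R}) (U : pointedType) (D : set U)
    (B : U -> set T) (F : set T) :
  measurable F -> mu F < +oo -> (forall i, D i -> measurable (B i)) ->
  trivIset D B -> countable [set i | D i /\ 0 < mu (B i `&` F)].
Proof.
move=> mF Foo mB tB.
rewrite [X in countable X](_ : _ =
    \bigcup_n [set i | D i /\ (n.+1%:R^-1)%:E < mu (B i `&` F)]); last first.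
  apply/seteqP; split=> [i/= [Di i0]|i/= [k _ [Di ki]]]; last first.
    by split => //; exact: lt_trans ki.
  have Boo : mu (B i `&` F) < +oo.
    apply: le_lt_trans Foo; apply: le_measure; rewrite ?inE//.
    by apply: measurableI => //; exact: mB.
  have Bfin : mu (B i `&` F) \is a fin_num by rewrite ge0_fin_numE.
  move: i0; rewrite -(fineK Bfin) lte_fin => /ltr_add_invr[k].
  rewrite add0r => ki; exists k => //; split => //.
  by rewrite -(fineK Bfin) lte_fin.
apply: bigcup_countable => // n _; apply: finite_set_countable.
apply: contrapT => /infiniteP/pcard_leP/injfunPex[/= q q_fun q_inj].
have mqF k : measurable (B (q k) `&` F).
  by apply: measurableI => //; apply: mB; exact: (q_fun k I).1.
have Ffin : mu F \is a fin_num by rewrite ge0_fin_numE.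
pose N := ((Num.truncn (fine (mu F))).+1 * n.+1)%N.
have : \sum_(k < N) mu (B (q k) `&` F) <= mu F.
  rewrite -(measure_semi_additive (fun k => B (q k) `&` F))//.
  - apply: le_measure; rewrite ?inE//.
      by apply: bigsetU_measurable => k _; exact: mqF.
    by rewrite -(bigcup_mkord N (fun k => B (q k) `&` F)) => x [k _ []].
  - move=> i j _ _ [x [[xi _] [xj _]]]; apply: q_inj; rewrite ?inE//.
    by apply: tB; [exact: (q_fun i I).1|exact: (q_fun j I).1|exists x].
  - by apply: bigsetU_measurable => k _; exact: mqF.
apply/negP; rewrite -ltNge.
apply: (@lt_le_trans _ _ (\sum_(k < N) (n.+1%:R^-1)%:E)); last first.
  by apply: lee_sum => k _; apply: ltW; exact: (q_fun k I).2.
rewrite sumEFin sumr_const card_ord -(fineK Ffin) lte_fin.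
rewrite -[ltRHS]mulr_natr natrM mulrC -mulrA mulfV ?pnatr_eq0// mulr1.
by rewrite truncnS_gt.
Qed.

Lemma countable_trivIset_measure_gt0 d (T : measurableType d) (R : realType)
    (mu : {sigma_finite_measure set T -> \bar R}) (U : pointedType) (D : set U)
    (B : U -> set T) :
  (forall i, D i -> measurable (B i)) -> (forall i, D i -> 0 < mu (B i)) ->
  trivIset D B -> countable D.
Proof.
move=> mB B0 tB; have [F FT /all_and2[mF Foo]] := sigma_finiteT mu.
suff -> : D = \bigcup_n [set i | D i /\ 0 < mu (B i `&` F n)].
  apply: bigcup_countable => // n _.
  exact: (countable_trivIset_finite_measure (mF n) (Foo n) mB tB).
apply/seteqP; split=> [i Di|i [n _ []//]].
apply: contrapT => nDi; have := B0 _ Di; apply/negP; rewrite -leNgt.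
have -> : B i = \bigcup_n (B i `&` F n) by rewrite -setI_bigcupr -FT setIT.
have mBF n : measurable (B i `&` F n) by apply: measurableI; [exact: mB|].
have mBU : measurable (\bigcup_n (B i `&` F n)) by apply: bigcup_measurable.
apply: le_trans (measure_sigma_subadditive mu mBF mBU (@subset_refl _ _)) _.
rewrite eseries0// => n _ _; apply/eqP; rewrite eq_le measure_ge0 andbT leNgt.
by apply/negP => BF0; apply: nDi; exists n.
Qed.

(** * Powers of extended nonnegative reals *)

Lemma lee_poweR (R : realType) (x y : \bar R) (r : R) :
  (0 <= r)%R -> 0 <= x -> x <= y -> x `^ r <= y `^ r.
Proof.
move=> r0 x0 xy; have y0 : 0 <= y by exact: le_trans xy.
by apply: gt0_ler_poweR => //; rewrite in_itv/= leey andbT.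
Qed.

(** Testing on the real numbers a <= x / 2 avoids the division of an infinite
x by 2. *)
Lemma poweR_le_of_halves (R : realType) (p : R) (x y : \bar R) :
  (1 <= p)%R -> 0 <= x -> 0 <= y ->
  (forall a : R, (0 < a)%R -> (a + a)%:E <= x -> (a `^ p)%:E <= y) ->
  x `^ p <= (2 `^ p)%:E * y.
Proof.
move=> p1 x0 y0 H; have p0 : (0 < p)%R by exact: lt_le_trans p1.
move: x x0 H => [r| |]//; rewrite ?lee_fin => r0 H.
- move: r0; rewrite le_eqVlt => /predU1P[<-|r0].
    by rewrite poweR0r ?gt_eqF// mule_ge0// lee_fin powR_ge0.
  have r20 : (0 < r / 2)%R by rewrite divr_gt0.
  have := H _ r20; rewrite -splitr poweR_EFin => /(_ (lexx _)) Hr.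
  have -> : (r `^ p = 2 `^ p * (r / 2) `^ p)%R.
    by rewrite -powRM ?ltW// mulrC divfK// pnatr_eq0.
  by rewrite EFinM lee_pmul2l// lte_fin powR_gt0.
- case: y y0 H => [s| |]// s0 H.
    have a1 : (1 <= s + 1)%R by rewrite lerDr -lee_fin.
    have := H (s + 1)%R (lt_le_trans ltr01 a1) (leey _).
    rewrite lee_fin leNgt => /negP; case.
    by apply: lt_le_trans (le1r_powR a1 p1); rewrite ltrDl.
  by rewrite gt0_muley ?leey// lte_fin powR_gt0.
Qed.

Lemma young_poweR (R : realType) (p q a : R) (b : \bar R) :
  (1 < p)%R -> (0 < q)%R -> (p^-1 + q^-1 = 1)%R -> (0 <= a)%R -> 0 <= b ->
  a%:E * b <= (a `^ p)%:E + b `^ q.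
Proof.
move=> p1 q0 pq a0; have p0 : (0 < p)%R by exact: lt_trans p1.
have le1V (r s : R) : (0 < r -> 0 < s -> r^-1 + s^-1 = 1 -> r^-1 <= 1)%R.
  by move=> r0 s0 <-; rewrite lerDl invr_ge0 ltW.
case: b => [b| |]//; last by rewrite poweRyr ?gt_eqF// addey ?leey.
rewrite lee_fin => b0; rewrite poweR_EFin -EFinM -EFinD lee_fin.
apply: le_trans (conjugate_powR a0 b0 p0 q0 pq) _.
apply: lerD; apply: ler_piMr; rewrite ?powR_ge0//; first exact: le1V pq.
by apply: le1V p0 _ => //; rewrite addrC.
Qed.

(** * Kernels with a quasi-metric minimum inequality *)

Section quasi_metric_min.
Context d (T : measurableType d) (R : realType).
Variables (K : T -> T -> \bar R) (c : R).
Hypothesis c1 : (1 <= c)%R.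
Hypothesis K_gt0 : forall x y, 0 < K x y.
Hypothesis K_sym : forall x y, K x y = K y x.
Hypothesis K_min :
  forall x y z, Order.min (K x z) (K z y) <= c%:E * K x y.

Let c0 : (0 < c)%R. Proof. exact: lt_le_trans c1. Qed.

Let K_ge0 x y : 0 <= K x y. Proof. exact: ltW. Qed.

(** The minimum inequality in the form in which it composes along a chain of
points, the comparison constants being multiplied by c at each step. *)
Lemma quasi_min_scaled (a b t : R) (m : \bar R) x y z :
  (0 < a <= t)%R -> (0 < b <= t)%R -> m <= a%:E * K x z -> m <= b%:E * K z y ->
  m <= (t * c)%:E * K x y.
Proof.
move=> /andP[a0 at_] /andP[b0 bt] mxz mzy.
have t0 : (0 < t)%R by exact: lt_le_trans at_.
rewrite EFinM -muleA -lee_pdivrMl//; apply: le_trans (K_min x y z).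
rewrite le_min !lee_pdivrMl//; apply/andP; split.
  by apply: le_trans mxz _; apply: lee_wpmul2r; rewrite ?lee_fin.
by apply: le_trans mzy _; apply: lee_wpmul2r; rewrite ?lee_fin.
Qed.

Hypothesis K_meas : forall x, measurable_fun [set: T] (K x).

Lemma measurable_superlevel (t : R) (m : \bar R) x :
  measurable [set y | m <= t%:E * K x y].
Proof.
rewrite -[X in measurable X]setTI.
exact: (emeasurable_fun_c_infty measurableT (measurable_funeM _ (K_meas x)) m).
Qed.

(** E is a countable union of squares G i * G i of enlarged balls centred at the
points i of D, where the balls B i, i in D, form a maximal disjoint family
among those of positive measure. If mu (B x) > 0, then B x meets some B i, and
two steps of the minimum inequality put x and all of B x in G i. If
mu (B x) = 0, almost no y has to be covered. *)
Lemma superlevel_ae_cover (mu : {sigma_finite_measure set T -> \bar R})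
    (m : R) :
  exists E : set (T * T),
    [/\ measurable E,
        forall z, E z -> m%:E <= (c ^+ 3)%:E * K z.1 z.2 &
        forall x, {ae mu, forall y, m%:E <= K x y -> E (x, y)}].
Proof.
pose B i := [set y | m%:E <= 1%:E * K i y].
pose G i := [set y | m%:E <= (c ^+ 2)%:E * K i y].
have mB i : measurable (B i) by exact: measurable_superlevel.
have mG i : measurable (G i) by exact: measurable_superlevel.
have [D [D0 tD maxD]] :=
  ex_maximal_disjoint_subcollection B [set i | 0 < mu (B i)].
have cD : countable D.
  by apply: (countable_trivIset_measure_gt0 (mu := mu) (B := B)).
exists (\bigcup_(i in D) (G i `*` G i)); split.
- move/pcard_geP : cD => [g].
  have -> : \bigcup_(i in D) (G i `*` G i) =
            \bigcup_(n in g @^-1` D) (G (g n) `*` G (g n)).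
    apply/seteqP; split=> [z [i Di Gz]|z [n Dn Gz]]; last by exists (g n).
    by have [n _ gni] := @surj _ _ _ _ g _ Di; exists n; rewrite /= gni.
  by apply: bigcup_measurable => n _; exact: measurableX.
- move=> [x y] [i _ [/= Gx Gy]]; rewrite exprSr.
  apply: (quasi_min_scaled (a := c ^+ 2) (z := i) _ _ _ Gy).
  + by rewrite lexx exprn_gt0.
  + by rewrite lexx exprn_gt0.
  + by rewrite K_sym.
- move=> x; have [Bx0|Bx0] := leP (mu (B x)) 0.
    apply: (@negligibleS _ _ _ _ (B x)) => [y /= /not_implyP[+ _]|].
      by rewrite /B/= mul1e.
    by apply/negligibleP => //; apply/eqP; rewrite eq_le Bx0 measure_ge0.
  have [i Di [z [Biz Bxz]]] : exists2 i, D i & B i `&` B x !=set0.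
    apply: contrapT => noi; apply: (maxD (D `|` [set x])).
    - split; first exact: subsetUl.
      move=> /(_ x (or_intror erefl)) Dx; apply: noi; exists x => //.
      rewrite setIid; apply/set0P/eqP => BE.
      by move: Bx0; rewrite BE measure0 ltxx.
    - by move=> j [/D0//|->].
    - move=> j k [Dj|->] [Dk|->]//.
      + exact: tD.
      + by move=> jx; exfalso; apply: noi; exists j.
      + by rewrite setIC => kx; exfalso; apply: noi; exists k.
  apply: aeW => y Kxy.
  have Kix : m%:E <= (1 * c)%:E * K i x.
    by apply: (quasi_min_scaled (b := 1) _ _ Biz); rewrite ?ltr01 ?lexx// K_sym.
  exists i => //; split => /=.
    rewrite /G/=; apply: le_trans Kix _; apply: lee_wpmul2r => //.
    by rewrite lee_fin mul1r ler_eXnr.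
  apply: (quasi_min_scaled (t := c) _ _ Kix (b := 1)).
  + by rewrite mul1r lexx c0.
  + by rewrite ltr01 c1.
  + by rewrite mul1e.
Qed.


(** L is the supremum over the nonnegative rationals m of m / c^3 on the set
provided by superlevel_ae_cover at level m. It suffices to use countably many
levels, so the exceptional null sets can be gathered into one for each x. *)
Lemma measurable_kernel_minorant (mu : {sigma_finite_measure set T -> \bar R}) :
  exists L : T * T -> \bar R,
    [/\ measurable_fun [set: T * T] L, forall z, 0 <= L z,
        forall z, L z <= K z.1 z.2 &
        forall x, {ae mu, forall y, K x y <= (c ^+ 3)%:E * L (x, y)}].
Proof.
have c30 : (0 < c ^+ 3)%R by rewrite exprn_gt0.
pose q n : rat := odflt 0%R (unpickle n); pose m n : R := `|ratr (q n)|%R.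
have [E hE] := choice (fun n => superlevel_ae_cover mu (m n)).
have {hE}[mE EK aeE] := all_and3 hE.
pose f n (z : T * T) : \bar R := ((m n / c ^+ 3) * \1_(E n) z)%:E.
have f0 n z : 0 <= f n z.
  by rewrite lee_fin mulr_ge0// divr_ge0 ?normr_ge0 ?ltW.
have f_sup n z : f n z <= esups (f ^~ z) 0%N.
  by apply: ereal_sup_ubound; exists n.
exists (fun z => esups (f ^~ z) 0%N); split.
- apply: measurable_fun_esups => n; apply/measurable_EFinP.
  by apply: measurable_funM => //; exact: measurable_indic.
- by move=> z; exact: le_trans (f_sup 0%N z).
- move=> z; apply: ge_ereal_sup => _ [n _ <-]; rewrite /f indicE.
  have [/set_mem Ez|_] := boolP (z \in E n); last by rewrite mulr0.
  by rewrite mulr1 mulrC EFinM lee_pdivrMl//; exact: EK.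
- move=> x; have : {ae mu, forall y, forall n, (m n)%:E <= K x y -> E n (x, y)}.
    by apply: ae_foralln => n; exact: aeE.
  apply: filterS => y Ey; set l := esups _ _.
  rewrite leNgt; apply/negP => lK.
  have l0 : 0 <= l by exact: le_trans (f_sup 0%N (x, y)).
  have [r /andP[lr rK]] : exists r : rat,
      (c ^+ 3)%:E * l < (ratr r)%:E < K x y.
    have : (c ^+ 3)%:E * l < +oo by rewrite (lt_le_trans lK)// leey.
    have : 0 <= (c ^+ 3)%:E * l by rewrite mule_ge0// lee_fin ltW.
    move: lK; case: (_ * l) (K x y) => [a| |] [b| |]// ab _ _.
      by have [r] := rat_in_itvoo ab; rewrite in_itv/= -!lte_fin => ?; exists r.
    have /rat_in_itvoo[r] : (a < a + 1)%R by rewrite ltrDl.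
    by rewrite in_itv/= => /andP[ar _]; exists r; rewrite lte_fin ar ltry.
  have r0 : (0 <= ratr r :> R)%R.
    by rewrite -lee_fin ltW// (le_lt_trans _ lr)// mule_ge0// lee_fin ltW.
  have mr : m (pickle r) = ratr r by rewrite /m /q pickleK/= ger0_norm.
  have := f_sup (pickle r) (x, y); apply/negP; rewrite -ltNge -/l.
  rewrite /f mr indicE mem_set ?mulr1; last by apply: Ey; rewrite mr ltW.
  by rewrite mulrC EFinM lte_pdivlMl.
Qed.

(** The pointwise inequality, with a function u in place of the potential of g,
which it dominates up to the constant b: u will be a measurable substitute for
the potential. *)
Lemma potential_poweR_le (mu : {measure set T -> \bar R}) (p b : R)
    (g : T -> R) (u : T -> \bar R) (x : T) :
  (1 < p)%R -> (0 < b)%R -> (forall y, (0 <= g y)%R) ->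
  measurable_fun [set: T] g -> measurable_fun [set: T] u ->
  (forall y, 0 <= u y) ->
  (forall y, \int[mu]_z (K y z * (g z)%:E) <= b%:E * u y) ->
  (\int[mu]_y (K x y * (g y)%:E)) `^ p <=
    (2 `^ p * (b * (2 * c)) `^ (p - 1))%:E *
    \int[mu]_y (K x y * (g y)%:E * u y `^ (p - 1)).
Proof.
move=> p1 b0 g0 mg meas_u u0 gu.
have p10 : (0 < p - 1)%R by rewrite subr_gt0.
have bc0 : (0 < b * (2 * c))%R by rewrite !mulr_gt0.
have mEg : measurable_fun [set: T] (EFin \o g) by exact/measurable_EFinP.
have mKg y : measurable_fun [set: T] (fun z => K y z * (g z)%:E).
  by apply: emeasurable_funM => //; exact: K_meas.
have Kg0 y z : 0 <= K y z * (g z)%:E by rewrite mule_ge0// lee_fin.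
have up0 y : 0 <= u y `^ (p - 1) by exact: poweR_ge0.
have mup : measurable_fun [set: T] (fun y => u y `^ (p - 1)).
  exact: (measurableT_comp (measurable_poweR _) meas_u).
rewrite EFinM -muleA; apply: poweR_le_of_halves.
- exact: ltW.
- exact: integral_ge0.
- rewrite mule_ge0 ?lee_fin ?powR_ge0//.
  by apply: integral_ge0 => y _; exact: mule_ge0.
move=> a a0 aK.
have [A [B [mA mB AB aA aB]]] :=
  integral_level_split (K_meas x) (K_gt0 x) (mKg x) (Kg0 x) a0 aK.
(* Where K x is above its median level, the potential of g is bounded below by
   a multiple of its value at x. *)
have uA y : A y -> (a / (b * (2 * c)))%:E <= u y.
  move=> Ay; rewrite mulrC EFinM lee_pdivrMl// mulrC EFinM -muleA.
  apply: (@le_trans _ _ ((2 * c)%:E *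
      \int[mu]_z (K y z * (g z)%:E))); last first.
    by rewrite lee_pmul2l ?lte_fin ?mulr_gt0.
  rewrite -ge0_integralZl//; last by rewrite lee_fin mulr_ge0// ltW.
  have mcKg :
      measurable_fun [set: T] (fun z => (2 * c)%:E * (K y z * (g z)%:E)).
    exact: measurable_funeM.
  have cKg0 z : 0 <= (2 * c)%:E * (K y z * (g z)%:E).
    by rewrite mule_ge0// lee_fin mulr_ge0// ltW.
  apply: (@le_trans _ _ (\int[mu]_(z in B)
      ((2 * c)%:E * (K y z * (g z)%:E)))); last first.
    exact: ge0_subset_integral.
  apply: le_trans aB _; apply: ge0_le_integral => //.
  - exact: measurable_funS (mKg x).
  - exact: measurable_funS mcKg.
  - move=> z Bz; rewrite muleA; apply: lee_wpmul2r; first by rewrite lee_fin.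
    apply: (quasi_min_scaled (a := 2) (b := 1) (z := x));
      rewrite ?ltr01 ?ltr0n ?lexx ?ler1n//.
    + by rewrite (K_sym y); exact: AB.
    + by rewrite mul1e.
have wA y : A y -> ((a / (b * (2 * c))) `^ (p - 1))%:E <= u y `^ (p - 1).
  move=> Ay; rewrite -poweR_EFin; apply: lee_poweR; first exact: ltW.
    by rewrite lee_fin ltW// divr_gt0.
  exact: uA.
have -> : (a `^ p = (b * (2 * c)) `^ (p - 1) *
    ((a / (b * (2 * c))) `^ (p - 1) * a))%R.
  rewrite mulrA -powRM ?divr_ge0// ?ltW// (mulrC _ (a / _))%R divfK ?gt_eqF//.
  rewrite -{3}[a]powRr1 ?ltW// -powRD; last by rewrite (gt_eqF a0) implybT.
  by rewrite subrK.
rewrite EFinM; apply: lee_wpmul2l; first by rewrite lee_fin powR_ge0.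
apply: (@le_trans _ _ (\int[mu]_(y in A)
    (K x y * (g y)%:E * u y `^ (p - 1)))); last first.
  apply: ge0_subset_integral => //; first exact: emeasurable_funM.
  by move=> y _; exact: mule_ge0.
apply: (@le_trans _ _ (\int[mu]_(y in A)
    (((a / (b * (2 * c))) `^ (p - 1))%:E * (K x y * (g y)%:E)))); last first.
  apply: ge0_le_integral => //.
  - by move=> y _; rewrite mule_ge0// lee_fin powR_ge0.
  - by apply: measurable_funeM; exact: measurable_funS (mKg x).
  - by apply: measurable_funS (measurableT) _ _ => //; exact: emeasurable_funM.
  - by move=> y Ay; rewrite muleC lee_wpmul2l// wA.
rewrite ge0_integralZl//; last 2 first.
  exact: measurable_funS (mKg x).
  by rewrite lee_fin powR_ge0.
by rewrite EFinM lee_wpmul2l// lee_fin powR_ge0.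
Qed.

(** A constant depending only on c and p serves all g at once, so a weight
condition on the last integral turns into the trace inequality for omega. *)
Lemma trace_le_weight (sigma omega : {sigma_finite_measure set T -> \bar R})
    (p q : R) : (1 < p)%R -> (p^-1 + q^-1 = 1)%R ->
  exists2 C : R, (0 <= C)%R & forall g : T -> R,
    measurable_fun [set: T] g -> (forall x, (0 <= g x)%R) ->
    \int[omega]_x ((\int[sigma]_y (K x y * (g y)%:E)) `^ p) <=
      C%:E * (\int[sigma]_x (g x `^ p)%:E +
        \int[sigma]_x ((\int[omega]_y K x y) `^ q *
                       (\int[sigma]_y (K x y * (g y)%:E)) `^ p)).
Proof.
move=> p1 pq; have p0 : (0 < p)%R by exact: lt_trans p1.
have p10 : (0 < p - 1)%R by rewrite subr_gt0.
have qE : (q^-1 = (p - 1) / p)%R.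
  by rewrite mulrBl divff ?gt_eqF// mul1r -pq addrAC subrr add0r.
have q0 : (0 < q)%R by rewrite -invr_gt0 qE divr_gt0.
have pq1 : ((p - 1) * q = p)%R.
  by rewrite -[q]invrK qE invf_div mulrC divfK// gt_eqF.
have c30 : (0 < c ^+ 3)%R by exact: exprn_gt0.
have [L [mL L0 LK KL]] := measurable_kernel_minorant sigma.
exists (2 `^ p * (c ^+ 3 * (2 * c)) `^ (p - 1) * c ^+ 3)%R.
  by rewrite !mulr_ge0 ?powR_ge0// ltW.
move=> g mg g0.
have mEg : measurable_fun [set: T] (EFin \o g) by exact/measurable_EFinP.
have mgs : measurable_fun [set: T * T] (fun z => (g z.2)%:E).
  exact: (measurableT_comp mEg measurable_snd).
have mLg : measurable_fun [set: T * T] (fun z => L z * (g z.2)%:E).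
  exact: emeasurable_funM.
have Lg0 z : 0 <= L z * (g z.2)%:E by rewrite mule_ge0// lee_fin.
(* Measurable substitutes for K g and K omega, which they bound from below. *)
pose u y := \int[sigma]_z (L (y, z) * (g z)%:E).
pose v y := \int[omega]_x L (x, y).
have meas_u : measurable_fun [set: T] u.
  exact: (measurable_fun_fubini_tonelli_F (m2 := sigma) _ mLg Lg0).
have mv : measurable_fun [set: T] v.
  exact: (measurable_fun_fubini_tonelli_G (m1 := omega) _ mL L0).
have u0 y : 0 <= u y by apply: integral_ge0 => z _; exact: (Lg0 (y, z)).
have v0 y : 0 <= v y by exact: integral_ge0.
have uK y : u y <= \int[sigma]_z (K y z * (g z)%:E).
  apply: ge0_le_integral_lower => z; first exact: (Lg0 (y, z)).
  by apply: lee_wpmul2r; [rewrite lee_fin|exact: (LK (y, z))].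
have vK y : v y <= \int[omega]_x K y x.
  by apply: ge0_le_integral_lower => // x; rewrite K_sym; exact: (LK (x, y)).
pose h y := (g y)%:E * u y `^ (p - 1).
have mup : measurable_fun [set: T] (fun y => u y `^ (p - 1)).
  exact: (measurableT_comp (measurable_poweR _) meas_u).
have mh : measurable_fun [set: T] h by exact: emeasurable_funM.
have h0 y : 0 <= h y by rewrite mule_ge0// ?lee_fin// poweR_ge0.
have mLh : measurable_fun [set: T * T] (fun z => L z * h z.2).
  by apply: emeasurable_funM => //; exact: (measurableT_comp mh measurable_snd).
have Lh0 z : 0 <= L z * h z.2 by exact: mule_ge0.
have KL_le x (f : T -> \bar R) : measurable_fun [set: T] f ->
    (forall y, 0 <= f y) ->
    \int[sigma]_y (K x y * f y) <= (c ^+ 3)%:E * \int[sigma]_y (L (x, y) * f y).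
  move=> mf f0; have mLf : measurable_fun [set: T] (fun y => L (x, y) * f y).
    by apply: emeasurable_funM => //; exact: measurable_fun_pair2.
  rewrite -ge0_integralZl//; last by rewrite lee_fin ltW.
    apply: ae_ge0_le_integral => //.
    - by move=> y _; rewrite mule_ge0.
    - by apply: emeasurable_funM => //; exact: K_meas.
    - by move=> y _; rewrite !mule_ge0// lee_fin ltW.
    - exact: measurable_funeM.
    - by apply: filterS (KL x) => y Kxy _; rewrite muleA lee_wpmul2r.
  by move=> y _; exact: mule_ge0.
have Kgp x : (\int[sigma]_y (K x y * (g y)%:E)) `^ p <=
    (2 `^ p * (c ^+ 3 * (2 * c)) `^ (p - 1) * c ^+ 3)%:E *
    \int[sigma]_y (L (x, y) * h y).
  apply: le_trans (potential_poweR_le x p1 c30 g0 mg meas_u u0 _) _.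
    by move=> y; apply: KL_le => // z; rewrite lee_fin.
  rewrite (EFinM _ (c ^+ 3)) -[leRHS]muleA; apply: lee_wpmul2l.
    by rewrite lee_fin mulr_ge0// powR_ge0.
  under eq_integral do rewrite -muleA.
  exact: KL_le.
apply: le_trans (ge0_le_integral_lower omega (fun x => poweR_ge0 _ _) Kgp) _.
rewrite ge0_integralZl//; last 3 first.
  exact: (measurable_fun_fubini_tonelli_F (m2 := sigma) _ mLh Lh0).
  by move=> x _; apply: integral_ge0 => y _; exact: (Lh0 (x, y)).
  by rewrite lee_fin !mulr_ge0 ?powR_ge0// ltW.
apply: lee_wpmul2l; first by rewrite lee_fin !mulr_ge0 ?powR_ge0// ltW.
(* The exchange of integrals takes place for L, with h = g u^(p-1). *)
rewrite (fubini_tonelli (m1 := omega) (m2 := sigma) _ mLh Lh0)/=.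
have mgp : measurable_fun [set: T] (fun y => (g y `^ p)%:E).
  by apply/measurable_EFinP; exact: (measurableT_comp (measurable_powR _) mg).
have mupvq : measurable_fun [set: T] (fun y => v y `^ q * u y `^ p).
  apply: emeasurable_funM.
  - exact: (measurableT_comp (measurable_poweR _) mv).
  - exact: (measurableT_comp (measurable_poweR _) meas_u).
apply: (@le_trans _ _ (\int[sigma]_y ((g y `^ p)%:E + v y `^ q * u y `^ p))).
  apply: ge0_le_integral_lower => y.
    by apply: integral_ge0 => x _; exact: (Lh0 (x, y)).
  rewrite ge0_integralZr//; last exact: measurable_fun_pair1.
  rewrite -/(v y) /h muleC -muleA (muleC _ (v y)).
  apply: le_trans (young_poweR p1 q0 pq (g0 y) _) _.
    by rewrite mule_ge0// poweR_ge0.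
  by rewrite poweRM ?poweR_ge0// -poweRrM pq1.
rewrite ge0_integralD//; last 2 first.
  by move=> y _; rewrite lee_fin powR_ge0.
  by move=> y _; rewrite mule_ge0 ?poweR_ge0.
apply: leeD2l; apply: ge0_le_integral_lower => y.
  by rewrite mule_ge0 ?poweR_ge0.
apply: lee_pmul; rewrite ?poweR_ge0//; apply: lee_poweR => //; exact: ltW.
Qed.

End quasi_metric_min.

(** * Quasi-metric kernels on a metric space *)

(** Both 1 / a and 1 / b are at most 1 / min(a, b). *)
Lemma min_le_quasi_triangle (R : realType) (kappa : R) (a b c : \bar R) :
  (1 <= kappa)%R -> 0 < a -> 0 < b -> 0 < c ->
  c^-1 <= kappa%:E * (a^-1 + b^-1) -> Order.min a b <= (2 * kappa)%:E * c.
Proof.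
move=> k1 a0 b0 c0 cab; have k0 : (0 < kappa)%R by exact: lt_le_trans k1.
set m := Order.min a b.
have m0 : 0 < m by rewrite lt_min a0.
have mV z : m <= z -> z^-1 <= m^-1.
  by move=> mz; rewrite lee_pV2// inE ltW//; exact: lt_le_trans mz.
have cm : c^-1 <= (2 * kappa)%:E * m^-1.
  apply: le_trans cab _; rewrite mulrC EFinM -muleA; apply: lee_wpmul2l.
    by rewrite lee_fin ltW.
  rewrite mule_natl mule2n.
  by apply: leeD; apply: mV; rewrite /m ge_min lexx ?orbT.
have k20 : (0 < 2 * kappa)%R by rewrite mulr_gt0.
have [->|cNy] := eqVneq c +oo; first by rewrite gt0_muley ?lte_fin// leey.
have c_fin : c \is a fin_num by rewrite ge0_fin_numE ?ltey ?ltW.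
have [mE|mNy] := eqVneq m +oo.
  move: cm; rewrite mE invey mule0 => c_le0.
  by move: cNy; rewrite -(inve_eq0 c) eq_le c_le0 inve_ge0 ltW.
have m_fin : m \is a fin_num by rewrite ge0_fin_numE ?ltey ?ltW.
move: cm m0 c0; rewrite -(fineK m_fin) -(fineK c_fin) !lte_fin => cm m0 c0.
move: cm; rewrite !inver !gt_eqF// -!EFinM !lee_fin.
by rewrite ler_pdivlMr// mulrC ler_pdivrMr.
Qed.

(** The embedding of X in X * X as a section is continuous, so the sections of
K are Borel although K may not be measurable for the product sigma-algebra. *)
Lemma measurable_kernel_section (R : realType) (X : pMetricType R)
    (K : X -> X -> \bar R) (x : X) : quasi_metric_kernel K ->
  measurable_fun [set: borel X] (K x : borel X -> \bar R).
Proof.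
move=> hK.
have mx : measurable_fun [set: borel X]
    ((fun y => (x, y)) : borel X -> borel (X * X)%type).
  apply: (@measurability _ _ (borel X) (borel (X * X)%type) setT _
    (@open (X * X)%type)); first by [].
  move=> _ [U oU <-].
  rewrite setTI; apply: sub_sigma_algebra.
  apply: (open_comp _ oU) => y _.
  by apply: cvg_pair; [exact: cvg_cst|exact: cvg_id].
exact: (measurableT_comp (qmk_measurable hK) mx).
Qed.

Theorem proposition4p5 (R : realType) (X : pMetricType R)
  (K : X -> X -> \bar R) (hK : quasi_metric_kernel K)
  (sigma omega : {sigma_finite_measure set (borel X) -> \bar R})
  (p q : R) (hp : (1 < p)%R) (hpq : (p^-1 + q^-1 = 1)%R)
  (hfin : {ae sigma, forall x : borel X, potential K omega x < +oo})
  (hweight : exists C : R, forall g : borel X -> R,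
    (forall x, (0 <= g x)%R) -> g \in Lfun sigma p%:E ->
    \int[sigma]_x (potential K omega x `^ q * fun_potential K sigma g x `^ p)
      <= C%:E * \int[sigma]_x (g x `^ p)%:E) :
  exists C' : R, forall g : borel X -> R,
    (forall x, (0 <= g x)%R) -> g \in Lfun sigma p%:E ->
    \int[omega]_x (fun_potential K sigma g x `^ p)
      <= C'%:E * \int[sigma]_x (g x `^ p)%:E.
Proof.
have [kappa [k1 tri]] := qmk_quasi_triangle hK.
have [C0 hC0] := hweight.
have K0 := qmk_gt0 hK.
have c1 : (1 <= 2 * kappa)%R.
  by rewrite (le_trans k1)// ler_peMl ?ler1n// (le_trans _ k1).
have Kmin (x y z : borel X) :
    Order.min (K x z) (K z y) <= (2 * kappa)%:E * K x y.
  exact: min_le_quasi_triangle (tri x y z).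
have [C C_ge0 hC] := @trace_le_weight _ (borel X) R K _ c1 K0 (qmk_sym hK)
  Kmin (fun x => measurable_kernel_section x hK) sigma omega p q hp hpq.
(* The absolute value, because C0 may be negative. *)
exists (C * (1 + `|C0|))%R => g g0 gL.
have mg : measurable_fun [set: borel X] g.
  by move: gL => /sub_Lfun_mfun; rewrite inE.
have G0 : 0 <= \int[sigma]_x (g x `^ p)%:E.
  by apply: integral_ge0 => x _; rewrite lee_fin powR_ge0.
apply: le_trans (hC g mg g0) _; rewrite EFinM -muleA.
apply: lee_wpmul2l; first by rewrite lee_fin.
rewrite EFinD ge0_muleDl ?lee_fin// mul1e; apply: leeD2l.
apply: le_trans (hC0 g g0 gL) _; apply: lee_wpmul2r => //.
by rewrite lee_fin ler_norm.
Qed.
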